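(* Let $G$ be a commutative group and let $h\colon R\to S$ be a morphism of $G$-graded commutative rings. Then $\sigma^h$ is an epimorphism and $\widetilde\rho^h$ is a monomorphism; that is, for every $G$-graded $S$-module $N$, the morphism $\sigma^h_N$ is an epimorphism and the morphism $\widetilde\rho^h_N$ is a monomorphism in $\mathrm{Mod}^G(S)$.
   Context: All groups and rings are commutative (rings unital). $\mathrm{Mod}^G(R)$ is the category of $G$-graded $R$-modules with degree-preserving $R$-linear maps; $M(g)$ is the shift, $M(g)_{g'}=M_{g+g'}$. The tensor product $M\otimes_RN$ is graded with $x\otimes y$ in degree $\deg x+\deg y$. $\mathrm{Hom}^G_R(M,N)=\bigoplus_{g\in G}\mathrm{Hom}_{\mathrm{Mod}^G(R)}(M,N(g))$, a $G$-graded $R$-module. $h_*\colon\mathrm{Mod}^G(S)\to\mathrm{Mod}^G(R)$ is restriction of scalars along $h$. $h^*(M)=S\otimes_RM$ (the graded tensor product $h_*(S)\otimes_RM$ with $s(t\otimes x)=(st)\otimes x$). $\widetilde h(M)=\mathrm{Hom}^G_R(h_*(S),M)$ with $S$-action $(su)(t)=u(st)$. For a $G$-graded $S$-module $N$: $\sigma^h_N\colon h^*(h_*(N))\to N$, $\sum_is_i\otimes x_i\mapsto\sum_is_ix_i$, and $\widetilde\rho^h_N\colon N\to\widetilde h(h_*(N))$, $x\mapsto(s\mapsto sx)$. *)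

(* Defs.v *)
From HB Require Import structures.
From mathcomp Require Import all_boot all_order all_algebra.
From mathcomp Require Import finmap.
From mathcomp Require Import boolp classical_sets functions cardinality fsbigop.
From mathcomp.multinomials Require Import freeg.

Set Implicit Arguments.
Unset Strict Implicit.
Unset Printing Implicit Defensive.

Import GRing.Theory.

Local Open Scope classical_set_scope.
Local Open Scope ring_scope.
Local Open Scope quotient_scope.

Section Grading.
Context {G V : zmodType}.
Implicit Types (gr : G -> set V) (x y : V) (f : G -> V).

Definition is_subgroup (A : set V) :=
  A 0 /\ forall x y, A x -> A y -> A (x - y).

Definition decomposes gr x f :=
  [/\ forall g, gr g (f g),
      finite_set (f @^-1` [set~ 0])
    & x = \sum_(g \in [set: G]) f g].

(* V is the internal direct sum of the subgroups (gr g) *)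
Definition is_grading gr :=
  (forall g, is_subgroup (gr g)) /\
  (forall x, exists! f, decomposes gr x f).

Lemma subgroupN A x : is_subgroup A -> A x -> A (- x).
Proof. by case=> A0 AB Ax; rewrite -[- x]add0r; exact: AB. Qed.

Lemma subgroupD A x y : is_subgroup A -> A x -> A y -> A (x + y).
Proof.
by move=> sA Ax Ay; rewrite -[y]opprK; apply: sA.2 => //; exact: subgroupN.
Qed.

Lemma subgroup_sum A I (s : seq I) (F : I -> V) :
  is_subgroup A -> (forall i, A (F i)) -> A (\sum_(i <- s) F i).
Proof.
move=> sA AF; elim/big_rec: _ => [|i x _ Ax]; first exact: sA.1.
exact: subgroupD.
Qed.

Lemma decomposesI gr x f (A : {fset G}) :
    (forall g, gr g (f g)) -> (forall g, g \notin A -> f g = 0) ->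
    x = \sum_(g <- A) f g ->
  decomposes gr x f.
Proof.
move=> grf f0 ->; split=> //; last by rewrite (@fsbigTE _ _ _ _ A).
apply: (sub_finite_set _ (finite_fset A)) => g /= fg.
by apply: contrapT => /negP gA; apply: fg; exact: f0.
Qed.

Lemma decomposesE gr x f : decomposes gr x f ->
  exists A : {fset G}, forall B : {fset G}, (A `<=` B)%fset ->
    (forall g, g \notin B -> f g = 0) /\ x = \sum_(g <- B) f g.
Proof.
case=> _ fin ->; exists (fset_set (f @^-1` [set~ 0])) => B AB.
have f0 g : g \notin B -> f g = 0.
  move=> gB; apply: contrapT => fg; move/negP: gB; apply.
  by apply: (fsubsetP AB); rewrite in_fset_set// inE.
by split=> //; rewrite (@fsbigTE _ _ _ _ B).
Qed.

Section Theory.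
Variable gr : G -> set V.
Hypothesis sgr : forall g, is_subgroup (gr g).

Lemma decomposes0 : decomposes gr 0 (fun=> 0).
Proof.
apply: (@decomposesI _ _ _ fset0) => //; first by move=> g; exact: (sgr g).1.
by rewrite big1.
Qed.

Lemma decomposesB x y f f' : decomposes gr x f -> decomposes gr y f' ->
  decomposes gr (x - y) (fun g => f g - f' g).
Proof.
move=> df df'; have [A hA] := decomposesE df; have [B hB] := decomposesE df'.
have [f0 xE] := hA _ (fsubsetUl A B); have [f'0 yE] := hB _ (fsubsetUr A B).
apply: (@decomposesI _ _ _ (A `|` B)%fset).
- by move=> g; apply: (sgr g).2; [case: df|case: df'].
- by move=> g gAB; rewrite f0// f'0// subrr.
- by rewrite sumrB -xE -yE.
Qed.

Lemma decomposes_hom g x :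
  gr g x -> decomposes gr x (fun h => if h == g then x else 0).
Proof.
move=> gx; apply: (@decomposesI _ _ _ [fset g]%fset).
- by move=> h; case: eqP => [->//|_]; exact: (sgr h).1.
- by move=> h; rewrite inE => /negbTE ->.
- by rewrite big_seq_fset1 eqxx.
Qed.

Lemma is_gradingI :
    (forall x, exists f, decomposes gr x f) ->
    (forall f, decomposes gr 0 f -> forall g, f g = 0) ->
  is_grading gr.
Proof.
move=> ex un; split=> // x; have [f df] := ex x; exists f; split=> // f' df'.
have := decomposesB df df'; rewrite subrr => /un d0.
by apply/funext => g; apply/subr0_eq/d0.
Qed.

End Theory.

Section Components.
Variable gr : G -> set V.
Hypothesis grG : is_grading gr.

Let sgr := grG.1.

Lemma decomposes_uniq x f f' :
  decomposes gr x f -> decomposes gr x f' -> f = f'.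
Proof. by have [f0 [_ u]] := grG.2 x => /u <- /u <-. Qed.

Definition hcomp x : G -> V := projT1 (cid (grG.2 x)).

Lemma hcompP x : decomposes gr x (hcomp x).
Proof. by rewrite /hcomp; case: cid => f []. Qed.

Lemma hcomp_gr x g : gr g (hcomp x g). Proof. by case: (hcompP x). Qed.

Lemma hcompE x f : decomposes gr x f -> hcomp x = f.
Proof. exact: decomposes_uniq (hcompP x). Qed.

Lemma hcompB x y g : hcomp (x - y) g = hcomp x g - hcomp y g.
Proof.
by rewrite (hcompE (decomposesB sgr (hcompP x) (hcompP y))).
Qed.

Lemma hcomp_hom g x : gr g x -> hcomp x = fun h => if h == g then x else 0.
Proof. by move=> gx; apply/hcompE/decomposes_hom. Qed.

Lemma grading_ind (P : V -> Prop) :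
    P 0 -> (forall x y, P x -> P y -> P (x + y)) ->
    (forall g x, gr g x -> P x) ->
  forall x, P x.
Proof.
move=> P0 PD Phom x; have [A /(_ A (fsubset_refl A))[_ ->]] :=
  decomposesE (hcompP x).
by elim/big_rec: _ => // g y _ Py; apply: PD => //; exact: Phom (hcomp_gr x g).
Qed.

End Components.
End Grading.

(* The zero ring is allowed (comPzRingType). Since G is a group, the unit is
   automatically of degree 0. *)
Record gradedRing (G : zmodType) := GradedRing {
  gring_sort :> comPzRingType;
  gring_deg : G -> set gring_sort;
  gring_grading : is_grading gring_deg;
  gring_degM : forall a b x y,
    gring_deg a x -> gring_deg b y -> gring_deg (a + b) (x * y)
}.

Record gradedRingHom (G : zmodType) (R S : gradedRing G) := GradedRingHom {
  gringhom_fun :> {rmorphism R -> S};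
  gringhom_deg : forall g r, gring_deg g r -> gring_deg g (gringhom_fun r)
}.

Record gradedMod (G : zmodType) (R : gradedRing G) := GradedMod {
  gmod_sort :> lmodType R;
  gmod_deg : G -> set gmod_sort;
  gmod_grading : is_grading gmod_deg;
  gmod_degZ : forall a b (r : R) x,
    gring_deg a r -> gmod_deg b x -> gmod_deg (a + b) (r *: x)
}.

Record gradedHom (G : zmodType) (R : gradedRing G) (M N : gradedMod R) :=
  GradedHom {
  ghom_fun :> M -> N;
  ghom_linear : linear ghom_fun;
  ghom_deg : forall g x, gmod_deg g x -> gmod_deg g (ghom_fun x)
}.

Section Category.
Context {G : zmodType} {R : gradedRing G}.
Implicit Types L M N P : gradedMod R.

Lemma ghom_ext M N (u v : gradedHom M N) : u =1 v -> u = v.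
Proof.
case: u v => [u lu du] [v lv dv] /= /funext uv; move: lu du lv dv.
by rewrite uv => *; congr GradedHom; exact: Prop_irrelevance.
Qed.

HB.instance Definition _ M N (u : gradedHom M N) :=
  GRing.isLinear.Build R M N *:%R (ghom_fun u) (ghom_linear u).

Fact ghom_id_linear M : linear (@id M). Proof. by []. Qed.

Definition ghom_id M : gradedHom M M :=
  @GradedHom _ _ M M id (@ghom_id_linear M) (fun _ _ => id).

Fact ghom_comp_linear L M N (v : gradedHom M N) (u : gradedHom L M) :
  linear (v \o u).
Proof. by move=> a x y /=; rewrite !linearP. Qed.

Definition ghom_comp L M N (v : gradedHom M N) (u : gradedHom L M) :
    gradedHom L N :=
  @GradedHom _ _ L N (v \o u) (ghom_comp_linear v u)
    (fun g x dx => ghom_deg v (ghom_deg u dx)).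

Definition monomorphism M N (f : gradedHom M N) :=
  forall L (u v : gradedHom L M), ghom_comp f u = ghom_comp f v -> u = v.

Definition epimorphism M N (f : gradedHom M N) :=
  forall P (u v : gradedHom N P), ghom_comp u f = ghom_comp v f -> u = v.

End Category.

Section Shift.
Context {G : zmodType} {R : gradedRing G} (M : gradedMod R) (g : G).

Let deg (a : G) : set M := gmod_deg (g + a).

Fact shift_grading : is_grading deg.
Proof.
have grM := gmod_grading M; apply: is_gradingI => [a|x|f df a].
- exact: grM.1.
- move: (hcompP grM x); move: (hcomp grM x) => f df.
  have [A /(_ A (fsubset_refl A))[f0 xE]] := decomposesE df.
  exists (fun a => f (g + a)).
  apply: (@decomposesI _ _ _ _ _ [fset (a - g)%R | a in A]%fset).
  + by move=> a; case: df => + _ _; exact.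
  + move=> a aA; apply: f0; apply: contra aA => aA.
    by apply/imfsetP; exists (g + a) => //=; rewrite addrAC subrr add0r.
  + rewrite big_imfset/=; last by move=> a b _ _ /addIr.
    by rewrite [LHS]xE; apply: eq_bigr => a _; rewrite addrC subrK.
- have [A /(_ A (fsubset_refl A))[f0 xE]] := decomposesE df.
  have d : decomposes (@gmod_deg _ _ M) 0 (fun a => f (a - g)).
    apply: (@decomposesI _ _ _ _ _ [fset (g + a)%R | a in A]%fset).
    + move=> b; case: df => /(_ (b - g)) + _ _.
      by rewrite /deg addrC subrK.
    + move=> b bA; apply: f0; apply: contra bA => bA.
      by apply/imfsetP; exists (b - g) => //=; rewrite addrC subrK.
    + rewrite big_imfset/=; last by move=> ? ? _ _ /addrI.
      by rewrite [LHS]xE; apply: eq_bigr => b _; rewrite addrAC subrr add0r.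
  have := decomposes_uniq grM d (decomposes0 grM.1).
  move=> /(congr1 (@^~ (g + a))); by rewrite addrAC subrr add0r.
Qed.

Fact shift_degZ a b (r : R) x : gring_deg a r -> deg b x -> deg (a + b) (r *: x).
Proof. by move=> ar bx; rewrite /deg addrCA; exact: gmod_degZ. Qed.

Definition shift : gradedMod R := GradedMod shift_grading shift_degZ.

End Shift.

Section Regular.
Context {G : zmodType} (S : gradedRing G).

(* S as a graded module over itself *)
Definition gregular : gradedMod S :=
  @GradedMod _ S S^o (@gring_deg _ S) (gring_grading S) (@gring_degM _ S).

End Regular.

Section Restriction.
Context {G : zmodType} {R S : gradedRing G} (h : gradedRingHom R S).

(* h_*: same group and degrees, with r acting as h r *)
Definition restr_sort (N : gradedMod S) : Type := N.

Section Def.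
Variable N : gradedMod S.

HB.instance Definition _ := GRing.Zmodule.copy (restr_sort N) N.

Definition restr_scale (r : R) (x : restr_sort N) : restr_sort N :=
  h r *: (x : N).

Fact restr_scaleA a b x : restr_scale a (restr_scale b x) = restr_scale (a * b) x.
Proof. by rewrite /restr_scale scalerA rmorphM. Qed.

Fact restr_scale1 : left_id 1 restr_scale.
Proof. by move=> x; rewrite /restr_scale rmorph1 scale1r. Qed.

Fact restr_scaleDr : right_distributive restr_scale +%R.
Proof. by move=> a x y; rewrite /restr_scale scalerDr. Qed.

Fact restr_scaleDl x : {morph restr_scale^~ x : a b / a + b}.
Proof. by move=> a b; rewrite /restr_scale rmorphD scalerDl. Qed.

HB.instance Definition _ := GRing.Zmodule_isLmodule.Build R (restr_sort N)
  restr_scaleA restr_scale1 restr_scaleDr restr_scaleDl.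

Fact restr_degZ a b (r : R) (x : restr_sort N) :
  gring_deg a r -> gmod_deg b (x : N) -> gmod_deg (a + b) (r *: x : N).
Proof. by move=> ar bx; apply: gmod_degZ => //; exact: gringhom_deg. Qed.

Definition restr : gradedMod R :=
  @GradedMod _ R (restr_sort N) (@gmod_deg _ S N) (gmod_grading N) restr_degZ.

End Def.
End Restriction.

(* Tensor product of modules: the free abelian group on M * N modulo the
   subgroup generated by the bilinearity relations *)

Section Tensor.
Context {R : comPzRingType} (M N : lmodType R).

Inductive tens_rel : {freeg (M * N)} -> Prop :=
| TensRel0 : tens_rel 0
| TensRelB u v : tens_rel u -> tens_rel v -> tens_rel (u - v)
| TensRelDl x x' y :
    tens_rel (<< (x + x', y) >> - << (x, y) >> - << (x', y) >>)
| TensRelDr x y y' :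
    tens_rel (<< (x, y + y') >> - << (x, y) >> - << (x, y') >>)
| TensRelZ (r : R) x y : tens_rel (<< (r *: x, y) >> - << (x, r *: y) >>).

Definition tens_relb : {pred {freeg (M * N)}} := fun u => `[< tens_rel u >].

Fact tens_rel_zmod_closed : zmod_closed tens_relb.
Proof.
split; first exact/asboolP/TensRel0.
by move=> u v /asboolP ru /asboolP rv; exact/asboolP/TensRelB.
Qed.

HB.instance Definition _ :=
  GRing.isZmodClosed.Build {freeg (M * N)} tens_relb tens_rel_zmod_closed.

Definition tens : Type := Quotient.quot tens_relb.

HB.instance Definition _ := GRing.Zmodule.on tens.

Definition pure (x : M) (y : N) : tens :=
  \pi_(Quotient.quot tens_relb) << (x, y) >>.

Lemma tens_relE (u v : {freeg (M * N)}) : tens_rel (u - v) ->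
  \pi_(Quotient.quot tens_relb) u = \pi_(Quotient.quot tens_relb) v.
Proof.
by move=> ruv; apply/eqP; rewrite -Quotient.idealrBE; exact/asboolP.
Qed.

Lemma pureDl x x' y : pure (x + x') y = pure x y + pure x' y.
Proof.
rewrite /pure -[RHS]raddfD; apply: tens_relE.
by rewrite opprD addrA; exact: TensRelDl.
Qed.

Lemma pureDr x y y' : pure x (y + y') = pure x y + pure x y'.
Proof.
rewrite /pure -[RHS]raddfD; apply: tens_relE.
by rewrite opprD addrA; exact: TensRelDr.
Qed.

Lemma pureZ r x y : pure (r *: x) y = pure x (r *: y).
Proof. exact/tens_relE/TensRelZ. Qed.

Lemma pure0l y : pure 0 y = 0.
Proof. by apply: (addrI (pure 0 y)); rewrite -pureDl !addr0. Qed.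

Lemma pure0r x : pure x 0 = 0.
Proof. by apply: (addrI (pure x 0)); rewrite -pureDr !addr0. Qed.

Lemma tens_ind (P : tens -> Prop) :
    P 0 -> (forall t u, P t -> P u -> P (t - u)) -> (forall x y, P (pure x y)) ->
  forall t, P t.
Proof.
move=> P0 PB Pp t.
have PN u : P u -> P (- u) by move=> Pu; rewrite -[- u]add0r; exact: PB.
have PD u v : P u -> P v -> P (u + v).
  by move=> Pu Pv; rewrite -[v]opprK; apply: PB => //; exact: PN.
have PM u n : P u -> P (u *+ n).
  by move=> Pu; elim: n => [|n IH]; rewrite ?mulr0n// mulrS; exact: PD.
rewrite -[t]reprK -[repr t]freeg_sumE raddf_sum.
elim/big_rec: _ => // z u _ Pu; apply: PD => //; case: z => x y.
set c := coeff _ _.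
have -> : << c *g (x, y) >> = << (x, y) >> *~ c.
  by rewrite freegU_mulz intz.
by rewrite raddfMz; case: c => n; [exact/PM/Pp|exact/PN/PM/Pp].
Qed.

Definition balanced (A : zmodType) (f : M -> N -> A) :=
  [/\ forall x x' y, f (x + x') y = f x y + f x' y,
      forall x y y', f x (y + y') = f x y + f x y'
    & forall r x y, f (r *: x) y = f x (r *: y)].

(* The additive map with pure x y |-> f x y, meaningful when f is balanced *)
Definition tens_lift (A : zmodType) (f : M -> N -> A) (t : tens) : A :=
  fglift (fun xy : M * N => f xy.1 xy.2 : zmodule A) (repr t).

Section Lift.
Context {A : zmodType} (f : M -> N -> A) (bf : balanced f).

Let flift : {freeg (M * N)} -> zmodule A :=
  fglift (fun xy : M * N => f xy.1 xy.2 : zmodule A).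

Let fliftB u v : flift (u - v) = flift u - flift v.
Proof. exact: lift_is_additive. Qed.

Let fliftU x y : flift << (x, y) >> = f x y.
Proof. by rewrite /flift liftU scale1r. Qed.

Let flift_rel u : tens_rel u -> flift u = 0.
Proof.
have [fDl fDr fZ] := bf; elim=> {u} [|u v _ u0 _ v0|x x' y|x y y'|r x y].
- by have := fliftB 0 0; rewrite !subrr.
- by rewrite fliftB u0 v0 subrr.
- by rewrite !fliftB !fliftU fDl addrAC addrK subrr.
- by rewrite !fliftB !fliftU fDr addrAC addrK subrr.
- by rewrite fliftB !fliftU fZ subrr.
Qed.

Let tens_lift_pi u : tens_lift f (\pi_(Quotient.quot tens_relb) u) = flift u.
Proof.
apply/subr0_eq; rewrite -fliftB; apply: flift_rel; apply/asboolP.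
by rewrite -/(tens_relb _) -[X in is_true X]/(_ \in tens_relb)
  Quotient.idealrBE reprK.
Qed.

Lemma tens_liftE x y : tens_lift f (pure x y) = f x y.
Proof. by rewrite tens_lift_pi fliftU. Qed.

Lemma tens_liftB t u : tens_lift f (t - u) = tens_lift f t - tens_lift f u.
Proof.
rewrite -[t]reprK -[u]reprK -[in LHS]raddfB !tens_lift_pi; exact: fliftB.
Qed.

Lemma tens_lift0 : tens_lift f 0 = 0.
Proof. by have := tens_liftB 0 0; rewrite !subrr. Qed.

Lemma tens_liftD t u : tens_lift f (t + u) = tens_lift f t + tens_lift f u.
Proof.
by rewrite -[u in LHS]opprK -(sub0r u) !tens_liftB tens_lift0 sub0r opprK.
Qed.

End Lift.
End Tensor.

Section TensorMap.
Context {R : comPzRingType} {M N : lmodType R}.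

(* phi (x) id_N *)
Definition tens_mapl (phi : M -> M) : tens M N -> tens M N :=
  tens_lift (fun x y => pure (phi x) y).

Lemma balanced_mapl phi : linear phi -> 
  @balanced _ M N (tens M N) (fun x y => pure (phi x) y).
Proof.
move=> lphi; split=> [x x' y|x y y'|r x y].
- by have := lphi 1 x x'; rewrite !scale1r => ->; rewrite pureDl.
- by rewrite pureDr.
- have := lphi r x 0; have := lphi (-1) 0 0.
  by rewrite scaler0 addr0 scaleN1r addNr => ->; rewrite !addr0 => ->; rewrite pureZ.
Qed.

Lemma tens_maplE phi x y :
  linear phi -> tens_mapl phi (pure x y) = pure (phi x) y.
Proof. by move=> lphi; exact: (tens_liftE (balanced_mapl lphi)). Qed.

Lemma tens_maplB phi t u :
  linear phi -> tens_mapl phi (t - u) = tens_mapl phi t - tens_mapl phi u.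
Proof. by move=> lphi; exact: (tens_liftB (balanced_mapl lphi)). Qed.

Lemma tens_mapl0 phi : linear phi -> tens_mapl phi 0 = 0.
Proof. by move=> lphi; exact: (tens_lift0 (balanced_mapl lphi)). Qed.

Lemma tens_maplD phi t u :
  linear phi -> tens_mapl phi (t + u) = tens_mapl phi t + tens_mapl phi u.
Proof. by move=> lphi; exact: (tens_liftD (balanced_mapl lphi)). Qed.

(* A ring acting R-linearly on M acts on tens M N. *)
Section Action.
Context {T : pzRingType} (act : T -> M -> M).
Hypothesis act_linear : forall s, linear (act s).
Hypothesis actA : forall s t x, act s (act t x) = act (s * t) x.
Hypothesis act1 : forall x, act 1 x = x.
Hypothesis actD : forall s t x, act (s + t) x = act s x + act t x.

Lemma tens_actA s t u :
  tens_mapl (act s) (tens_mapl (act t) u) = tens_mapl (act (s * t)) u.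
Proof.
elim/(@tens_ind _ M N): u => [|u v Pu Pv|x y]; first by rewrite !tens_mapl0.
- by rewrite !tens_maplB// Pu Pv.
- by rewrite !tens_maplE// actA.
Qed.

Lemma tens_act1 : left_id 1 (fun s => tens_mapl (act s)).
Proof.
elim/(@tens_ind _ M N) => [|u v Pu Pv|x y]; first by rewrite !tens_mapl0.
- by rewrite !tens_maplB// Pu Pv.
- by rewrite !tens_maplE// act1.
Qed.

Lemma tens_actDr : right_distributive (fun s => tens_mapl (act s)) +%R.
Proof. by move=> s t u; rewrite tens_maplD. Qed.

Lemma tens_actDl u : {morph (fun s => tens_mapl (act s) u) : s t / s + t}.
Proof.
move=> s t; elim/(@tens_ind _ M N): u => [|u v Pu Pv|x y].
- by rewrite !tens_mapl0// addr0.
- by rewrite !tens_maplB// Pu Pv opprD addrACA.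
- by rewrite !tens_maplE// actD pureDl.
Qed.

End Action.

Section Lmodule.

Fact scale_linear (r : R) : linear ( *:%R r : M -> M).
Proof. by move=> a x y; rewrite scalerDr !scalerA mulrC. Qed.

HB.instance Definition _ := GRing.Zmodule_isLmodule.Build R (tens M N)
  (tens_actA scale_linear (@scalerA _ M)) (tens_act1 scale_linear (@scale1r _ M))
  (tens_actDr scale_linear)
  (tens_actDl scale_linear (fun s t x => @scalerDl _ M x s t)).

Lemma tens_scaleE (r : R) (x : M) (y : N) : r *: pure x y = pure (r *: x) y.
Proof. exact: tens_maplE (scale_linear r). Qed.

End Lmodule.
End TensorMap.

Section GradedTensor.
Context {G : zmodType} {R : gradedRing G} (M N : gradedMod R).

(* The subgroup generated by the pure x y with deg x + deg y = g *)
Inductive tens_deg (g : G) : tens M N -> Prop :=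
| TensDeg0 : tens_deg g 0
| TensDegB t u : tens_deg g t -> tens_deg g u -> tens_deg g (t - u)
| TensDegPure a b x y :
    gmod_deg a x -> gmod_deg b y -> a + b = g -> tens_deg g (pure x y).

Fact tens_deg_subgroup g : is_subgroup (tens_deg g : set (tens M N)).
Proof. by split; [exact: TensDeg0|exact: TensDegB]. Qed.

Let grM := gmod_grading M.
Let grN := gmod_grading N.

Let comp g (x : M) (y : N) : tens M N :=
  \sum_(a \in [set: G]) pure (hcomp grM x a) (hcomp grN y (g - a)).

Let comp_fset g x : exists A : {fset G},
  forall (B : {fset G}) y, (A `<=` B)%fset ->
  comp g x y = \sum_(a <- B) pure (hcomp grM x a) (hcomp grN y (g - a)).
Proof.
have [A hA] := decomposesE (hcompP grM x); exists A => B y /hA[f0 _].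
by rewrite /comp (@fsbigTE _ _ _ _ B)// => a /f0 ->; rewrite pure0l.
Qed.

Let hcomp0 (V : zmodType) (gr : G -> set V) (grV : is_grading gr) g : hcomp grV 0 g = 0.
Proof. by have := hcompB grV 0 0 g; rewrite !subrr. Qed.

Let hcompD (V : zmodType) (gr : G -> set V) (grV : is_grading gr) x y g :
  hcomp grV (x + y) g = hcomp grV x g + hcomp grV y g.
Proof.
by rewrite -[y in LHS]opprK -(sub0r y) !hcompB hcomp0 sub0r opprK.
Qed.

Let compDl g x x' y : comp g (x + x') y = comp g x y + comp g x' y.
Proof.
have [A hA] := comp_fset g x; have [B hB] := comp_fset g x'.
have [C hC] := comp_fset g (x + x').
rewrite (hA (A `|` B `|` C)%fset) ?(hB (A `|` B `|` C)%fset)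
  ?(hC (A `|` B `|` C)%fset) ?fsubsetUr//.
- by rewrite -big_split; apply: eq_bigr => a _; rewrite hcompD pureDl.
- by rewrite -fsetUA fsetUCA fsubsetUl.
- by rewrite -fsetUA fsubsetUl.
Qed.

Let compDr g x y y' : comp g x (y + y') = comp g x y + comp g x y'.
Proof.
have [A hA] := comp_fset g x; rewrite !(hA A)// -big_split.
by apply: eq_bigr => a _; rewrite hcompD pureDr.
Qed.

Let comp_hom g a b x y : gmod_deg a x -> gmod_deg b y ->
  comp g x y = if a + b == g then pure x y else 0.
Proof.
move=> ax byy; rewrite /comp (@fsbigTE _ _ _ _ [fset a]%fset) => [|c].
- rewrite big_seq_fset1 (hcomp_hom grM ax) (hcomp_hom grN byy) eqxx.
  by rewrite subr_eq [b + a]addrC eq_sym; case: eqP => // _; rewrite pure0r.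
- by rewrite inE (hcomp_hom grM ax) => /negbTE ->; rewrite pure0l.
Qed.

Let comp_balanced g : balanced (comp g).
Proof.
split; [exact: compDl|exact: compDr|].
have c0l y : comp g 0 y = 0.
  by apply: (addrI (comp g 0 y)); rewrite -compDl !addr0.
have c0r x : comp g x 0 = 0.
  by apply: (addrI (comp g x 0)); rewrite -compDr !addr0.
move=> r x y; move: r x y.
apply: (grading_ind (gring_grading R)) => [x y|r s Pr Ps x y|c r cr x y].
- by rewrite !scale0r c0l c0r.
- by rewrite !scalerDl compDl compDr Pr Ps.
move: x y; apply: (grading_ind grM) => [y|x x' Px Px' y|a x ax].
- by rewrite scaler0 !c0l.
- by rewrite scalerDr !compDl Px Px'.
apply: (grading_ind grN) => [|y y' Py Py'|b y b_y].
- by rewrite scaler0 !c0r.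
- by rewrite scalerDr !compDr Py Py'.
rewrite (comp_hom g (gmod_degZ cr ax) b_y) (comp_hom g ax (gmod_degZ cr b_y)).
by rewrite pureZ addrCA addrA.
Qed.

Let comp_deg g a t : tens_deg a t ->
  tens_lift (comp g) t = if a == g then t else 0.
Proof.
have bc := comp_balanced g.
elim=> [|u v _ Pu _ Pv|b c x y bx cy <-].
- by rewrite tens_lift0// if_same.
- by rewrite tens_liftB// Pu Pv; case: eqP => // _; rewrite subrr.
- by rewrite tens_liftE// (comp_hom g bx cy).
Qed.

Fact tens_grading : is_grading (tens_deg : G -> set (tens M N)).
Proof.
apply: (is_gradingI tens_deg_subgroup) => [|f df g].
  pose Q t := exists f, decomposes tens_deg t f.
  have Q0 : Q 0 by exists (fun=> 0); exact: (decomposes0 tens_deg_subgroup).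
  have QB t u : Q t -> Q u -> Q (t - u).
    by move=> [f df] [f' df']; eexists; exact: (decomposesB tens_deg_subgroup df df').
  have QD t u : Q t -> Q u -> Q (t + u).
    by move=> Qt Qu; rewrite -[u]opprK -(sub0r u); do 2!apply: (QB) => //.
  apply: (@tens_ind _ M N) => //; apply: (grading_ind grM) => [y|x x' Px Px' y|a x ax].
  - by rewrite pure0l.
  - by rewrite pureDl; exact: QD.
  apply: (grading_ind grN) => [|y y' Py Py'|b y b_y].
  - by rewrite pure0r.
  - by rewrite pureDr; exact: QD.
  - eexists; apply: (decomposes_hom tens_deg_subgroup (g := a + b)).
    exact: TensDegPure ax b_y erefl.
have bc := comp_balanced g.
have [A /(_ _ (fsubsetUl A [fset g]%fset))[f0 E]] := decomposesE df.
have fgr a : tens_deg a (f a) by case: df.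
have := tens_lift0 bc; rewrite E.
rewrite (big_morph _ (tens_liftD bc) (tens_lift0 bc)).
under eq_bigr do rewrite (comp_deg g (fgr _)).
rewrite (big_fsetD1 g)/=; last by rewrite !inE eqxx orbT.
rewrite eqxx big_seq big1 ?addr0// => a; rewrite !inE => /andP[/negbTE + _].
by move=> ->.
Qed.

Fact tens_degZ a b (r : R) t :
  gring_deg a r -> tens_deg b t -> tens_deg (a + b) (r *: t).
Proof.
move=> ar; elim=> [|u v _ Pu _ Pv|c d x y cx dy <-].
- by rewrite scaler0; exact: TensDeg0.
- by rewrite scalerBr; exact: TensDegB.
- rewrite tens_scaleE addrA; apply: (TensDegPure _ dy erefl).
  exact: gmod_degZ.
Qed.

Definition gtensor : gradedMod R := GradedMod tens_grading tens_degZ.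

End GradedTensor.

(* Hom^G(M, N) is realised as an internal direct sum: the maps M -> N that are
   finite sums of (underlying maps of) morphisms M -> N(g); ghom_grading shows
   that this sum is direct. *)

Section GradedHomModule.
Context {G : zmodType} {R : gradedRing G} (M N : gradedMod R).
Implicit Types u v : M -> N.

Definition homdeg (g : G) : set (M -> N) :=
  [set u | exists v : gradedHom M (shift N g), u = v :> (M -> N)].

Definition ghom_pred : {pred M -> N} :=
  fun u => `[< exists f, decomposes homdeg u f >].

Lemma homdegI g u : linear u ->
  (forall a x, gmod_deg a x -> gmod_deg (g + a) (u x)) -> homdeg g u.
Proof. by move=> lu du; exists (@GradedHom _ _ M (shift N g) u lu du). Qed.

Lemma homdeg_linear g u : homdeg g u -> linear u.
Proof. by move=> [v ->]; exact: (ghom_linear v). Qed.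

Lemma homdeg_deg g u a x :
  homdeg g u -> gmod_deg a x -> gmod_deg (g + a) (u x).
Proof. by move=> [v ->]; exact: (ghom_deg v). Qed.

Let grM := gmod_grading M.
Let grN := gmod_grading N.

Fact homdeg_subgroup g : is_subgroup (homdeg g).
Proof.
split=> [|u v du dv]; apply: homdegI.
- by move=> a x y; rewrite scaler0 addr0.
- by move=> a x _; exact: (grN.1 _).1.
- move=> a x y; rewrite -[LHS]/(u (a *: x + y) - v (a *: x + y)).
  rewrite (homdeg_linear du) (homdeg_linear dv).
  by rewrite scalerBr opprD addrACA.
- by move=> a x ax; apply: (grN.1 _).2; exact: homdeg_deg ax.
Qed.

Fact ghom_zmod_closed : zmod_closed ghom_pred.
Proof.
split; first by apply/asboolP; eexists; exact: (decomposes0 homdeg_subgroup).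
move=> u v /asboolP[f df] /asboolP[f' df']; apply/asboolP; eexists.
exact: (decomposesB homdeg_subgroup df df').
Qed.

HB.instance Definition _ :=
  GRing.isZmodClosed.Build (M -> N) ghom_pred ghom_zmod_closed.

Record ghom := GHom { ghom_val :> M -> N; _ : ghom_val \in ghom_pred }.

HB.instance Definition _ := [isSub for ghom_val].
HB.instance Definition _ := [Choice of ghom by <:].
HB.instance Definition _ := [SubChoice_isSubZmodule of ghom by <:].

Lemma ghom_pred_homdeg g u : homdeg g u -> u \in ghom_pred.
Proof.
by move=> du; apply/asboolP; eexists; exact: (decomposes_hom homdeg_subgroup du).
Qed.

Lemma ghom_pred_ind (P : (M -> N) -> Prop) :
    P 0 -> (forall u v, P u -> P v -> P (u + v)) ->
    (forall g u, homdeg g u -> P u) ->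
  forall u, u \in ghom_pred -> P u.
Proof.
move=> P0 PD Ph u /asboolP[f df].
have [A /(_ A (fsubset_refl A))[_ ->]] := decomposesE df.
elim/big_rec: _ => // g v _ Pv; apply: PD => //.
by case: df => + _ _ => /(_ g) /Ph.
Qed.

Lemma ghom_pred_linear u : u \in ghom_pred -> linear u.
Proof.
elim/ghom_pred_ind => [|v w lv lw|g v /homdeg_linear//] a x y.
- by rewrite scaler0 addr0.
- rewrite -[LHS]/(v (a *: x + y) + w (a *: x + y)) lv lw.
  by rewrite -[(v + w) x]/(v x + w x) scalerDr addrACA.
Qed.

Lemma ghom_linearP (u : ghom) : linear u.
Proof. exact/ghom_pred_linear/valP. Qed.

Definition ghom_deg_set (g : G) : set ghom := [set u : ghom | homdeg g u].

Fact ghom_grading : is_grading ghom_deg_set.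
Proof.
have sg g : is_subgroup (ghom_deg_set g).
  by split=> [|u v]; [exact: (homdeg_subgroup g).1|exact: (homdeg_subgroup g).2].
apply: (is_gradingI sg) => [u|f df g].
  have /asboolP[f df] := valP u.
  have [A /(_ A (fsubset_refl A))[f0 uE]] := decomposesE df.
  have fg g : homdeg g (f g) by case: df.
  pose f' g := GHom (ghom_pred_homdeg (fg g)).
  exists f'; apply: (@decomposesI _ _ _ _ _ A) => //.
  - by move=> g gA; apply: val_inj; rewrite /= f0.
  - by apply: val_inj; rewrite raddf_sum.
have [A /(_ A (fsubset_refl A))[f0 E]] := decomposesE df.
have fdeg h : homdeg h (f h) by case: df => /(_ h).
suff fg0 x : f g x = 0 by apply/val_inj/funext => x; exact: fg0.
elim/(grading_ind grM): x => [|x y fx fy|a x ax].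
- by have := ghom_linearP (f g) (-1) 0 0; rewrite scaleN1r addNr scaleN1r addNr.
- have := ghom_linearP (f g) 1 x y; rewrite !scale1r => ->.
  by rewrite fx fy addr0.
have d : decomposes (@gmod_deg _ _ (shift N a)) 0 (fun g => f g x).
  apply: (@decomposesI _ _ _ _ _ A).
  - by move=> b; rewrite /= addrC; exact: homdeg_deg.
  - by move=> b /f0 ->.
  - have := congr1 (fun u : ghom => u x) E.
    by rewrite -[RHS]/(val (\sum_(g <- A) f g) x) raddf_sum fct_sumE.
have gs := gmod_grading (shift N a).
by rewrite [LHS](congr1 (@^~ g) (decomposes_uniq gs d (decomposes0 gs.1))).
Qed.


(* Precomposition with a graded family of R-linear endomorphisms of M *)
Lemma ghom_pred_precomp (T : gradedRing G) (act : T -> M -> M) :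
    (forall s, linear (act s)) ->
    (forall x, {morph act^~ x : s t / s + t}) ->
    (forall a b s x, gring_deg a s -> gmod_deg b x -> gmod_deg (a + b) (act s x)) ->
  forall s u, u \in ghom_pred -> u \o act s \in ghom_pred.
Proof.
move=> lact actD dact s u pu; have lu := ghom_pred_linear pu.
have act0 x : act 0 x = 0.
  by apply: (addrI (act 0 x)); rewrite -actD !addr0.
have u0 : u 0 = 0 by have := lu (-1) 0 0; rewrite scaleN1r addNr scaleN1r addNr.
have uD x y : u (x + y) = u x + u y by have := lu 1 x y; rewrite !scale1r.
elim/(grading_ind (gring_grading T)): s => [|s t Ps Pt|a s a_s].
- have -> : u \o act 0 = 0 by apply/funext => x /=; rewrite act0 u0.
  exact: rpred0.
- have -> : u \o act (s + t) = (u \o act s) + (u \o act t).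
    by apply/funext => x /=; rewrite actD uD.
  exact: rpredD.
elim/ghom_pred_ind: pu {lu u0 uD} => [|v w Pv Pw|g v dv].
- exact: rpred0.
- have -> : (v + w) \o act s = (v \o act s) + (w \o act s) by [].
  exact: rpredD.
apply: (@ghom_pred_homdeg (g + a)); apply: homdegI => [c x y|b x bx] /=.
- by rewrite lact (homdeg_linear dv).
- by rewrite -addrA; apply: (homdeg_deg dv); exact: dact.
Qed.

Lemma homdeg_precomp a g (phi : M -> M) u : linear phi ->
    (forall b x, gmod_deg b x -> gmod_deg (a + b) (phi x)) ->
  homdeg g u -> homdeg (a + g) (u \o phi).
Proof.
move=> lphi dphi du; apply: homdegI => [c x y|b x bx] /=.
- by rewrite lphi (homdeg_linear du).
- by rewrite -addrA addrCA; apply: (homdeg_deg du); exact: dphi.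
Qed.

Fact ghom_scale_subproof (r : R) (u : ghom) : (fun x => r *: u x) \in ghom_pred.
Proof.
have -> : (fun x => r *: u x) = u \o *:%R r.
  apply/funext => x /=; have lu := ghom_linearP u.
  have := lu r x 0; have := lu (-1) 0 0.
  by rewrite scaleN1r addNr scaleN1r addNr => ->; rewrite !addr0.
apply: (ghom_pred_precomp (act := *:%R)); last exact: valP.
- exact: scale_linear.
- by move=> x s t; rewrite scalerDl.
- exact: (@gmod_degZ _ _ M).
Qed.

Definition ghom_scale (r : R) (u : ghom) : ghom := GHom (ghom_scale_subproof r u).

Fact ghom_scaleA a b (u : ghom) : ghom_scale a (ghom_scale b u) = ghom_scale (a * b) u.
Proof. by apply/val_inj/funext => x; rewrite /= scalerA. Qed.

Fact ghom_scale1 : left_id 1 ghom_scale.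
Proof. by move=> u; apply/val_inj/funext => x; rewrite /= scale1r. Qed.

Fact ghom_scaleDr : right_distributive ghom_scale +%R.
Proof. by move=> a u v; apply/val_inj/funext => x; exact: scalerDr. Qed.

Fact ghom_scaleDl (u : ghom) : {morph ghom_scale^~ u : a b / a + b}.
Proof. by move=> a b; apply/val_inj/funext => x; exact: scalerDl. Qed.

HB.instance Definition _ := GRing.Zmodule_isLmodule.Build R ghom
  ghom_scaleA ghom_scale1 ghom_scaleDr ghom_scaleDl.

Fact ghom_degZ a b (r : R) (u : ghom) :
  gring_deg a r -> ghom_deg_set b u -> ghom_deg_set (a + b) (r *: u).
Proof.
move=> ar bu; apply: homdegI => [c x y|d x dx].
- exact: ghom_linearP (r *: u) c x y.
- by rewrite -addrA; apply: gmod_degZ => //; exact: (homdeg_deg bu).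
Qed.

Definition ghom_mod : gradedMod R := GradedMod ghom_grading ghom_degZ.

End GradedHomModule.

Section ChangeOfRings.
Context {G : zmodType} {R S : gradedRing G} (h : gradedRingHom R S).

Local Notation hS := (restr h (gregular S)).

Definition mulS (s : S) : hS -> hS := fun t => s * (t : S).

Fact mulS_linear s : linear (mulS s).
Proof. by move=> r x y; rewrite /mulS mulrDr; congr (_ + _); exact: mulrCA. Qed.

Fact mulSA s t x : mulS s (mulS t x) = mulS (s * t) x.
Proof. exact: mulrA. Qed.

Fact mulS1 x : mulS 1 x = x.
Proof. exact: mul1r. Qed.

Fact mulSD s t x : mulS (s + t) x = mulS s x + mulS t x.
Proof. exact: mulrDl. Qed.

Fact mulS_deg a b (s : S) (x : hS) :
  gring_deg a s -> gmod_deg b x -> gmod_deg (a + b) (mulS s x).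
Proof. exact: gring_degM. Qed.

Section Extension.
Variable M : gradedMod R.

(* h^*(M) = S (x)_R M *)
Definition extend_sort : Type := gtensor hS M.

HB.instance Definition _ := GRing.Zmodule.copy extend_sort (gtensor hS M).

HB.instance Definition _ := GRing.Zmodule_isLmodule.Build S extend_sort
  (@tens_actA _ hS M _ mulS mulS_linear mulSA)
  (@tens_act1 _ hS M _ mulS mulS_linear mulS1)
  (@tens_actDr _ hS M _ mulS mulS_linear)
  (@tens_actDl _ hS M _ mulS mulS_linear mulSD).

Lemma extend_scaleE (s t : S) (x : M) :
  s *: (pure (t : hS) x : extend_sort) = pure (s * t : hS) x.
Proof. exact: (@tens_maplE _ hS M _ t x (mulS_linear s)). Qed.

Lemma extend_ind (P : extend_sort -> Prop) :
    P 0 -> (forall t u, P t -> P u -> P (t - u)) ->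
    (forall (s : S) (x : M), P (pure (s : hS) x)) ->
  forall t, P t.
Proof. exact: (@tens_ind _ hS M). Qed.

Fact extend_degZ a b (s : S) (t : extend_sort) :
  gring_deg a s -> tens_deg b t -> tens_deg (a + b) (s *: t).
Proof.
move=> a_s; elim=> [|u v _ Pu _ Pv|c d x y cx dy <-].
- by rewrite scaler0; exact: TensDeg0.
- by rewrite scalerBr; exact: TensDegB.
- rewrite extend_scaleE addrA; apply: (TensDegPure _ dy erefl).
  exact: gring_degM.
Qed.

Definition extend : gradedMod S :=
  @GradedMod _ S extend_sort (@tens_deg _ R hS M) (tens_grading hS M) extend_degZ.

End Extension.

Section Coextension.
Variable M : gradedMod R.

(* Hom^G_R(S, M) with S acting through the source, see coextend_scaleE *)
Definition coextend_sort : Type := ghom_mod hS M.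

HB.instance Definition _ := GRing.Zmodule.copy coextend_sort (ghom_mod hS M).

Definition coextend_scale (s : S) (u : coextend_sort) : coextend_sort :=
  GHom (ghom_pred_precomp mulS_linear (fun x s t => mulSD s t x) mulS_deg s (valP u)).

Fact coextend_scaleA a b u :
  coextend_scale a (coextend_scale b u) = coextend_scale (a * b) u.
Proof.
by apply/val_inj/funext => x; rewrite /= mulSA mulrC.
Qed.

Fact coextend_scale1 : left_id 1 coextend_scale.
Proof. by move=> u; apply/val_inj/funext => x; rewrite /= mulS1. Qed.

Fact coextend_scaleDr : right_distributive coextend_scale +%R.
Proof. by move=> a u v; apply/val_inj/funext. Qed.

Fact coextend_scaleDl u : {morph coextend_scale^~ u : a b / a + b}.
Proof.
move=> a b; apply/val_inj/funext => x /=; rewrite mulSD.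
by have := ghom_linearP u 1 (mulS a x) (mulS b x); rewrite !scale1r.
Qed.

HB.instance Definition _ := GRing.Zmodule_isLmodule.Build S coextend_sort
  coextend_scaleA coextend_scale1 coextend_scaleDr coextend_scaleDl.

Lemma coextend_scaleE (s t : S) (u : coextend_sort) :
  (s *: u : ghom hS M) (t : hS) = (u : ghom hS M) (s * t : hS).
Proof. by []. Qed.

Fact coextend_degZ a b (s : S) (u : coextend_sort) :
  gring_deg a s -> ghom_deg_set b u -> ghom_deg_set (a + b) (s *: u).
Proof.
move=> a_s; apply: homdeg_precomp; first exact: mulS_linear.
by move=> c x cx; exact: mulS_deg.
Qed.

Definition coextend : gradedMod S :=
  @GradedMod _ S coextend_sort (@ghom_deg_set _ R hS M) (ghom_grading hS M)
    coextend_degZ.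

End Coextension.

Section Canonical.
Variable N : gradedMod S.

Local Notation hN := (restr h N).

Definition sigma_fun : extend hN -> N :=
  @tens_lift _ hS hN N (fun (s : S) (x : N) => s *: x).

Fact sigma_balanced : @balanced _ hS hN N (fun (s : S) (x : N) => s *: x).
Proof.
split=> [s t x|s x y|r s x]; [exact: scalerDl|exact: scalerDr|].
by rewrite scalerA mulrC -scalerA.
Qed.

Lemma sigma_funE (s : S) (x : N) : sigma_fun (pure (s : hS) (x : hN)) = s *: x.
Proof. exact: tens_liftE sigma_balanced _ _. Qed.

Fact sigma_funB : {morph sigma_fun : t u / t - u}.
Proof. exact: (tens_liftB sigma_balanced). Qed.

Fact sigma_fun0 : sigma_fun 0 = 0.
Proof. exact: (tens_lift0 sigma_balanced). Qed.

Fact sigma_linear : linear sigma_fun.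
Proof.
move=> a t u; rewrite [LHS](tens_liftD sigma_balanced); congr (_ + _).
rewrite -/(sigma_fun (a *: t)).
elim/extend_ind: t => [|t v Pt Pv|s x].
- by rewrite scaler0 sigma_fun0 scaler0.
- by rewrite scalerBr !sigma_funB Pt Pv scalerBr.
- by rewrite extend_scaleE !sigma_funE scalerA.
Qed.

Fact sigma_deg g (t : extend hN) : gmod_deg g t -> gmod_deg g (sigma_fun t).
Proof.
have sg := (gmod_grading N).1 g.
elim=> [|u v _ Pu _ Pv|a b s x a_s bx <-].
- by rewrite sigma_fun0; exact: sg.1.
- by rewrite sigma_funB; exact: sg.2.
- by rewrite sigma_funE; exact: gmod_degZ.
Qed.

Definition sigma : gradedHom (extend hN) N := GradedHom sigma_linear sigma_deg.

Definition rho_map (x : N) : hS -> hN := fun s => (s : S) *: x.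

Fact rho_homdeg g (x : N) : gmod_deg g x -> homdeg g (rho_map x).
Proof.
move=> gx; apply: homdegI => [a s t|a s a_s].
- by rewrite /rho_map scalerDl -scalerA.
- by rewrite addrC; exact: gmod_degZ.
Qed.

Fact rho_subproof (x : N) : rho_map x \in @ghom_pred _ _ hS hN.
Proof.
elim/(grading_ind (gmod_grading N)): x => [|x y Px Py|g x gx].
- have -> : rho_map 0 = 0 by apply/funext => s; rewrite /rho_map scaler0.
  exact: rpred0.
- have -> : rho_map (x + y) = rho_map x + rho_map y.
    by apply/funext => s; rewrite /rho_map scalerDr.
  exact: rpredD.
- exact: ghom_pred_homdeg (rho_homdeg gx).
Qed.

Definition rho_fun (x : N) : coextend hN := GHom (rho_subproof x).

Fact rho_linear : linear rho_fun.
Proof.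
move=> a x y; apply/val_inj/funext => s.
rewrite -[LHS]/((s : S) *: (a *: x + y)) scalerDr scalerA mulrC.
by [].
Qed.

Fact rho_deg g (x : N) : gmod_deg g x -> gmod_deg g (rho_fun x).
Proof. exact: rho_homdeg. Qed.

Definition rho : gradedHom N (coextend hN) := GradedHom rho_linear rho_deg.

End Canonical.
End ChangeOfRings.

(* Main.v *)
Require Import Defs.
From mathcomp Require Import all_boot all_algebra.

Import GRing.Theory.
Local Open Scope ring_scope.

(** The unit of [S] makes [sigma] surjective and [rho] injective on underlying maps. Since a graded
    morphism is determined by its underlying map, cancellation can be checked on elements. *)

Lemma sigma_pure1 (G : zmodType) (R S : gradedRing G)
    (h : gradedRingHom R S) (N : gradedMod S) (x : N) :
  sigma h N (pure (1 : restr h (gregular S)) (x : restr h N)) = x.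
Proof. by rewrite [LHS]sigma_funE scale1r. Qed.

(** Evaluation at [1] sends [rho x] to [1 *: x], so it is a left inverse of [rho]. *)
Lemma rho_inj (G : zmodType) (R S : gradedRing G)
    (h : gradedRingHom R S) (N : gradedMod S) : injective (rho h N).
Proof.
move=> x y /(congr1 (fun u : ghom (restr h (gregular S)) (restr h N) =>
  u (1 : S))).
by rewrite /= /rho_map !scale1r.
Qed.

Theorem mainTheorem4 (G : zmodType) (R S : gradedRing G)
    (h : gradedRingHom R S) (N : gradedMod S) :
  epimorphism (sigma h N) /\ monomorphism (rho h N).
Proof.
split=> [P u v | L u v] /(congr1 (@ghom_fun _ _ _ _)) uv; apply: ghom_ext => x.
  (* Write [x] as the image of [1 ⊗ x], where the two composites agree. *)
  by rewrite -(sigma_pure1 G R S h N x); exact: (congr1 (@^~ _) uv).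
exact/(rho_inj G R S h N)/(congr1 (@^~ x) uv).
Qed.
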